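(* Let $T>0$ and let $\dot x=f_0(x,u_s)$, $y=h(x,u_s)$ be a deterministic grid model that has a unique solution on $[0,T]$ for each admissible interface signal $u_s$ and each initial grid state. Consider (i) a prescribed sinusoidal source, i.e. the interface signal is the explicit function $u_s(t)=a\sin(\omega t+\phi)$, and (ii) an unobserved one-way harmonic-oscillator source, i.e. the interface signal is $u_s(t)=Lz(t)$ where $z(t)\in\mathbb{R}^2$ solves $\dot z=S_\omega z$ with $S_\omega=\begin{bmatrix}0&\omega\\-\omega&0\end{bmatrix}$ and some initial state $z(0)$. If the two sources generate the same interface signal on $[0,T]$, then they are grid-side observationally equivalent on $[0,T]$. This holds even if the full grid state is measured, that is, even for the measurement map $h(x,u_s)=x$.
   Context: Two hidden-source models are called grid-side observationally equivalent on $[0,T]$ if, when connected to the same deterministic grid model with the same initial grid state, they produce identical measured trajectories $y(t)$ on $[0,T]$. Here $x$ is the grid state, $u_s$ the source-interface signal and $y$ the grid-side measurement. The two sources are connected to the grid through the same interface, with the same other applied inputs and the same measurement map, and each acts on the grid only through $u_s$. ''One-way'' means the source dynamics do not depend on the grid state $x$; ''unobserved'' means $z$ is not measured. Parameters: $a,\omega,\phi\in\mathbb{R}$, and $L$ is a constant $1\times 2$ real matrix. *)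

(* Defs.v *)
From HB Require Import structures.
From mathcomp Require Import all_boot all_order all_algebra.
From mathcomp Require Import all_classical all_reals all_analysis.
Set Implicit Arguments.
Unset Strict Implicit.
Unset Printing Implicit Defensive.
Import Order.TTheory GRing.Theory Num.Theory.
Import numFieldNormedType.Exports.
Local Open Scope classical_set_scope.
Local Open Scope ring_scope.

(* Signals and trajectories on [0, T] are total functions on R of which only
   the values on [0, T] matter. *)
Definition agree_on (R : realType) (V : Type) (T : R) (v w : R -> V) : Prop :=
  forall t : R, 0 <= t <= T -> v t = w t.

(* Classical solution of x' = F(t, x) on [0, T].  The difference quotient is
   restricted to [0, T], so the derivative is one-sided at 0 and at T. *)
Definition solves (R : realType) (V : normedModType R) (T : R)
    (F : R -> V -> V) (x : R -> V) : Prop :=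
  forall t : R, 0 <= t <= T ->
    (fun s => (s - t)^-1 *: (x s - x t)) @ within `[0, T] t^' --> F t (x t).

Definition grid_solution (R : realType) (n : nat) (T : R)
    (f0 : 'cV[R]_n -> R -> 'cV[R]_n) (x0 : 'cV[R]_n) (u : R -> R)
    (x : R -> 'cV[R]_n) : Prop :=
  x 0 = x0 /\ solves T (fun t xi => f0 xi (u t)) x.

Definition well_posed (R : realType) (n : nat) (T : R)
    (f0 : 'cV[R]_n -> R -> 'cV[R]_n) (adm : set (R -> R)) : Prop :=
  forall (u : R -> R) (x0 : 'cV[R]_n), adm u ->
    exists2 x, grid_solution T f0 x0 u x &
      forall x', grid_solution T f0 x0 u x' -> agree_on T x x'.

(* A hidden-source model is given by its external behaviour: [s x u] means that
   [u] is an interface signal which the source can deliver on [0, T] while the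
   grid state follows [x].  Any hidden state of the source is existentially
   quantified inside [s], so it is not available to the measurement. *)
Definition source (R : realType) (n : nat) : Type :=
  (R -> 'cV[R]_n) -> (R -> R) -> Prop.

Definition sinusoid (R : realType) (a omega phi : R) : R -> R :=
  fun t => a * sin (omega * t + phi).

Definition sinusoidal_source (R : realType) (n : nat) (T a omega phi : R) :
    source R n :=
  fun _ u => agree_on T u (sinusoid a omega phi).
Arguments sinusoidal_source {R} n T a omega phi.

Definition S_mx (R : realType) (omega : R) : 'M[R]_2 :=
  \matrix_(i, j) (nth [::] [:: [:: 0; omega]; [:: - omega; 0]] i)`_j.

(* One-way: the dynamics of [z] ignore the grid trajectory. *)
Definition oscillator_source (R : realType) (n : nat) (T omega : R)
    (L : 'M[R]_(1, 2)) (z0 : 'cV[R]_2) : source R n :=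
  fun _ u => exists z : R -> 'cV[R]_2,
    [/\ z 0 = z0,
        solves T (fun _ zeta => S_mx omega *m zeta) z &
        agree_on T u (fun t => (L *m z t) 0 0)].
Arguments oscillator_source {R} n T omega L z0.

Definition generates (R : realType) (n : nat) (s : source R n) (u : R -> R) :
    Prop :=
  forall x : R -> 'cV[R]_n, s x u.

Definition same_interface_signal (R : realType) (n : nat)
    (s1 s2 : source R n) : Prop :=
  exists u : R -> R, generates s1 u /\ generates s2 u.

(* [y] is a measured trajectory of the grid connected to the source [s]; the
   source acts on the grid and on the measurement only through [u]. *)
Definition produces (R : realType) (n p : nat) (T : R)
    (f0 : 'cV[R]_n -> R -> 'cV[R]_n) (h : 'cV[R]_n -> R -> 'cV[R]_p)
    (s : source R n) (x0 : 'cV[R]_n) (y : R -> 'cV[R]_p) : Prop :=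
  exists (x : R -> 'cV[R]_n) (u : R -> R),
    [/\ s x u, grid_solution T f0 x0 u x &
        agree_on T y (fun t => h (x t) (u t))].

(* The existence clauses exclude the degenerate case of a source for which the
   interconnection has no trajectory. *)
Definition grid_side_equivalent (R : realType) (n p : nat) (T : R)
    (f0 : 'cV[R]_n -> R -> 'cV[R]_n) (h : 'cV[R]_n -> R -> 'cV[R]_p)
    (s1 s2 : source R n) : Prop :=
  forall x0 : 'cV[R]_n,
    [/\ exists y, produces T f0 h s1 x0 y,
        exists y, produces T f0 h s2 x0 y &
        forall y1 y2, produces T f0 h s1 x0 y1 -> produces T f0 h s2 x0 y2 ->
          agree_on T y1 y2].

(* Main.v *)
Require Import Defs.
From mathcomp Require Import all_boot all_order all_algebra.
From mathcomp Require Import all_classical all_reals all_analysis.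
From mathcomp Require Import ring lra.
Import Order.TTheory GRing.Theory Num.Theory.
Import numFieldNormedType.Exports.
Local Open Scope classical_set_scope.
Local Open Scope ring_scope.

(* Two facts carry the argument.  On the grid side, well-posedness makes the
   state on [0, T] a function of the interface signal there.  On the source
   side, a given z(0) determines the oscillator signal: S_omega is skew, so the
   squared norm of the difference of two solutions is constant, hence zero.
   Since the sources share one signal, every signal either can deliver is the
   sinusoid. *)

Lemma agree_on_sym {R : realType} {V : Type} {T : R} {v w : R -> V} :
  agree_on T v w -> agree_on T w v.
Proof. by move=> vw t tT; rewrite vw. Qed.

Lemma agree_on_trans {R : realType} {V : Type} {T : R} {v w x : R -> V} :
  agree_on T v w -> agree_on T w x -> agree_on T v x.
Proof. by move=> vw wx t tT; rewrite vw// wx. Qed.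

Lemma solves_entry {R : realType} {n : nat} {T : R}
    {F : R -> 'cV[R]_n -> 'cV[R]_n} {x : R -> 'cV[R]_n} (i : 'I_n) :
  solves T F x -> forall t, 0 <= t <= T ->
  (fun s => (s - t)^-1 * (x s i 0 - x t i 0)) @ within `[0, T] t^'
    --> F t (x t) i 0.
Proof.
move=> sx t /sx xt.
have := cvg_comp _ _ xt (@coord_continuous _ _ _ i 0 _).
apply: cvg_trans; apply: near_eq_cvg; near=> s => /=.
by rewrite !mxE.
Unshelve. all: by end_near. Qed.

(** Away from [t], [f s] is [s - t] times the quotient plus [f t], which tends to [0 * d + f t]; at
    [t] itself there is nothing to show. This gives continuity at the ends of an interval, where the
    derivative is only one-sided. *)
Lemma within_quotient_continuous {R : realType} {A : set R} {f : R -> R}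
    {t d : R} :
  (fun s => (s - t)^-1 * (f s - f t)) @ within A t^' --> d ->
  f @ within A (nbhs t) --> f t.
Proof.
move=> fd.
have ft : f @ within A t^' --> f t.
  have st : (fun s => s - t) @ within A t^' --> 0.
    rewrite -(subrr t); apply: cvgB; last exact: cvg_cst.
    by move=> U tU; do 2 apply: cvg_within.
  have : (fun s => (s - t) * ((s - t)^-1 * (f s - f t)) + f t)
      @ within A t^' --> 0 * d + f t.
    by apply: cvgD; [exact: cvgM|exact: cvg_cst].
  rewrite mul0r add0r; apply: cvg_trans; apply: near_eq_cvg.
  rewrite !near_withinE; near=> s => st' _ /=.
  by rewrite mulrA divff ?mul1r ?subrK ?subr_eq0.
move=> U fU.
have H : \forall s \near t, s != t -> A s -> U (f s) := ft U fU.
change (\forall s \near t, A s -> U (f s)).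
apply: filterS H => s H As.
have [->|st] := eqVneq s t; first exact: nbhs_singleton fU.
exact: H.
Unshelve. all: by end_near. Qed.

(** Near an interior point of [A] the restriction to [A] is vacuous, and the substitution
    [s = h + t] turns the quotient into the one behind [is_derive]. *)
Lemma within_quotient_is_derive {R : realType} {A : set R} {f : R -> R}
    {t d : R} : nbhs t A ->
  (fun s => (s - t)^-1 * (f s - f t)) @ within A t^' --> d ->
  is_derive t 1 f d.
Proof.
move=> At fd.
have fd' : (fun s => (s - t)^-1 * (f s - f t)) @ t^' --> d.
  move=> U /fd HU.
  change (\forall s \near t^', U ((s - t)^-1 * (f s - f t))).
  near=> s; have As : A s by near: s; exact: nbhs_dnbhs.
  by move: As; near: s.
have ht : (fun h => h + t) @ 0^' --> t^'.
  move=> U HU; change (\forall h \near (0 : R), h != 0 -> U (h + t)).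
  have h0t : (fun h => h + t) @ 0 --> t.
    rewrite -[X in _ --> X]add0r.
    by apply: cvgD; [exact: cvg_id|exact: cvg_cst].
  have : \forall h \near (0 : R), h + t != t -> U (h + t) := h0t _ HU.
  apply: filterS => h Uh h0; apply: Uh.
  by rewrite -subr_eq0 addrK.
have H : h^-1 *: ((f \o shift t) (h *: 1) - f t) @[h --> 0^'] --> d.
  have := cvg_comp _ _ ht fd'.
  apply: cvg_trans; apply: near_eq_cvg; near=> h => /=.
  by rewrite addrK /GRing.scale/= mulr1.
apply: DeriveDef; first by apply/cvg_ex; exists d.
exact: cvg_lim H.
Unshelve. all: by end_near. Qed.

(** The left side is half the derivative of the squared norm along w' = S_omega w; its two terms in
    omega cancel. *)
Lemma S_mx_skew {R : realType} (omega : R) (w : 'cV[R]_2) :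
  w 0 0 * (S_mx omega *m w) 0 0 + w 1 0 * (S_mx omega *m w) 1 0 = 0.
Proof.
rewrite !mxE !big_ord_recl !big_ord0 !mxE /=.
have -> : lift ord0 ord0 = 1 :> 'I_2 by exact: val_inj.
by ring.
Qed.

Lemma oscillator_unique {R : realType} {T omega : R} {z z' : R -> 'cV[R]_2} :
  solves T (fun _ zeta => S_mx omega *m zeta) z ->
  solves T (fun _ zeta => S_mx omega *m zeta) z' ->
  z 0 = z' 0 -> agree_on T z z'.
Proof.
move=> sz sz' z0 t /andP[t0 tT].
pose w s i := z s i 0 - z' s i 0.
pose dw s i := (S_mx omega *m z s) i 0 - (S_mx omega *m z' s) i 0.
have wq s i : 0 <= s <= T ->
    (fun r => (r - s)^-1 * (w r i - w s i)) @ within `[0, T] s^' --> dw s i.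
  move=> sT.
  have : (fun r => (r - s)^-1 * (z r i 0 - z s i 0) -
                   (r - s)^-1 * (z' r i 0 - z' s i 0))
      @ within `[0, T] s^' --> dw s i.
    by apply: cvgB; [exact: (solves_entry i sz)|exact: (solves_entry i sz')].
  apply: cvg_trans; apply: near_eq_cvg; near=> r.
  by rewrite /w; ring.
(* The squared norm of the difference; by linearity of the dynamics, [we] says that half its
   derivative vanishes. *)
pose e s := w s 0 * w s 0 + w s 1 * w s 1.
have we s : w s 0 * dw s 0 + w s 1 * dw s 1 = 0.
  have := S_mx_skew omega (z s - z' s).
  rewrite mulmxBr /w /dw; move: (_ *m z s) (_ *m z' s) => b b'.
  by rewrite !mxE.
(* The mean value theorem asks for a two-sided derivative only strictly between 0 and [t], hence
   inside [0, T]; at the endpoints continuity within [0, t] suffices. *)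
have [c _] : exists2 c, c \in `[0, t] & e t - e 0 = 0 * (t - 0).
  apply: (@MVT_segment R e (fun=> 0)) => //.
    move=> s; rewrite in_itv/= => /andP[s0 st].
    have sT : 0 <= s <= T by lra.
    have sA : nbhs s [set` `[0, T]].
      apply: filterS (@near_in_itvoo _ 0 T s _); last by rewrite in_itv/=; lra.
      exact: subset_itv_oo_cc.
    have d0 := within_quotient_is_derive sA (wq s 0 sT).
    have d1 := within_quotient_is_derive sA (wq s 1 sT).
    apply: is_derive_eq.
    by have := we s; rewrite /GRing.scale/=; lra.
  have ww i : {within `[0, t], continuous (w ^~ i)}.
    apply/subspace_continuousP => s /=; rewrite in_itv/= => /andP[s0 st].
    have sT : 0 <= s <= T by lra.
    have := within_quotient_continuous (wq s i sT).
    apply: cvg_trans => U; apply: within_subset => r /=.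
    by rewrite !in_itv/=; lra.
  by move=> s; apply: cvgD; apply: cvgM; apply: ww.
rewrite mul0r {2}/e /w z0 !subrr !mulr0 addr0 subr0 => et.
have [w0 w1] : w t 0 = 0 /\ w t 1 = 0.
  by move: et; rewrite /e; nra.
apply/colP => i; apply/eqP; rewrite -subr_eq0 -/(w t i); apply/eqP.
case: i => [[|[|//]] ilt]; [rewrite -w0|rewrite -w1];
  by congr (w t _); exact: val_inj.
Unshelve. all: by end_near. Qed.

Lemma agree_on_grid_solution {R : realType} {n : nat} {T : R}
    {f0 : 'cV[R]_n -> R -> 'cV[R]_n} {x0 : 'cV[R]_n} {u v : R -> R}
    {x : R -> 'cV[R]_n} :
  agree_on T u v -> grid_solution T f0 x0 u x -> grid_solution T f0 x0 v x.
Proof.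
by move=> uv [x0E sx]; split=> // t tT; rewrite -uv//; exact: sx.
Qed.

(** A delivered signal may differ from [v] outside [0, T], and admissibility is known for [v] alone;
    solutions are therefore transported to [v] before uniqueness is applied. *)
Lemma single_signal_equivalent {R : realType} {n p : nat} {T : R}
    {f0 : 'cV[R]_n -> R -> 'cV[R]_n} (h : 'cV[R]_n -> R -> 'cV[R]_p)
    {adm : set (R -> R)} {s1 s2 : source R n} {v : R -> R} :
  well_posed T f0 adm -> adm v -> same_interface_signal s1 s2 ->
  (forall x u, s1 x u -> agree_on T u v) ->
  (forall x u, s2 x u -> agree_on T u v) ->
  grid_side_equivalent T f0 h s1 s2.
Proof.
move=> wp admv [u [s1u s2u]] s1v s2v x0.
have [x sx x_uniq] := wp v x0 admv.
(* In the other direction, the solution for [v] is moved to the shared signal [u], so both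
   interconnections have a trajectory. *)
have sxu := agree_on_grid_solution (agree_on_sym (s1v x u (s1u x))) sx.
split.
- by exists (fun t => h (x t) (u t)), x, u.
- by exists (fun t => h (x t) (u t)), x, u.
move=> y1 y2 [x1 [u1 [/s1v u1v sx1 y1E]]] [x2 [u2 [/s2v u2v sx2 y2E]]] t tT.
rewrite y1E// y2E// u1v// u2v//.
rewrite -(x_uniq _ (agree_on_grid_solution u1v sx1))//.
by rewrite -(x_uniq _ (agree_on_grid_solution u2v sx2)).
Qed.

Theorem corollary1 (R : realType) (n p : nat) (T : R) (hT : 0 < T)
    (f0 : 'cV[R]_n -> R -> 'cV[R]_n) (h : 'cV[R]_n -> R -> 'cV[R]_p)
    (adm : set (R -> R)) (hwp : well_posed T f0 adm)
    (a omega phi : R) (L : 'M[R]_(1, 2)) (z0 : 'cV[R]_2)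
    (hadm : adm (sinusoid a omega phi))
    (hsame : same_interface_signal (sinusoidal_source n T a omega phi)
                                   (oscillator_source n T omega L z0)) :
  grid_side_equivalent T f0 h
      (sinusoidal_source n T a omega phi)
      (oscillator_source n T omega L z0) /\
  grid_side_equivalent T f0 (fun x _ => x)
      (sinusoidal_source n T a omega phi)
      (oscillator_source n T omega L z0).
Proof.
(* The shared signal is the output of one run [z'] and agrees with the sinusoid. Any other run
   starts at the same [z0], so it coincides with [z'] on [0, T], and so do the outputs. *)
have osc_sin : forall x u, oscillator_source n T omega L z0 x u ->
    agree_on T u (sinusoid a omega phi).
  move=> x u [z [zz0 sz uE]].
  have [v [sinv oscv]] := hsame.
  have [z' [z'z0 sz' vE]] := oscv x.
  have zz' : agree_on T z z' by apply: oscillator_unique sz sz' _; rewrite zz0.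
  apply: agree_on_trans (sinv x).
  by move=> t tT; rewrite uE// vE// zz'.
(* The measurement map is arbitrary in the lemma, so full-state measurement is one more instance. *)
by split; apply: (single_signal_equivalent _ hwp hadm hsame).
Qed.
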